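(* For bipartite graphs $G$ on $n$ vertices, as $n \rightarrow \infty$, $$\chi_\ell^\star(G) \leq (1+o(1)) \log_2 n.$$
   Context: Graphs are finite and simple. The $o(1)$ term depends only on $n$: for every $\varepsilon>0$ there is $n_0$ such that the inequality holds with $1+\varepsilon$ in place of $1+o(1)$ for every bipartite graph on $n\ge n_0$ vertices. A list-assignment $L$ of $G$ maps each vertex $v\in V(G)$ to a set $L(v)\subseteq\mathbb{N}$ of colours; it is a $k$-list-assignment if $|L(v)|=k$ for every $v$. A proper $L$-colouring is a map $c:V(G)\to\mathbb{N}$ with $c(v)\in L(v)$ for all $v$ and $c(u)\neq c(v)$ for every edge $uv$. A proper $L$-packing of $G$ of size $k$ is a collection of $k$ proper $L$-colourings $c_1,\dots,c_k$ that are mutually disjoint, i.e. $c_i(v)\neq c_j(v)$ for all $i\neq j$ and all $v\in V(G)$. The list packing number $\chi^\star_\ell(G)$ is the least $k$ such that $G$ admits a proper $L$-packing of size $k$ for every $k$-list-assignment $L$ of $G$. *)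

(* Defs.v *)
From HB Require Import structures.
From mathcomp Require Import all_boot all_order all_algebra finmap.
From mathcomp Require Import reals exp.

Set Implicit Arguments.
Unset Strict Implicit.
Unset Printing Implicit Defensive.

Import Order.TTheory GRing.Theory Num.Theory.

Record sgraph := SGraph {
  vertex : finType;
  adj : rel vertex;
  adj_sym : symmetric adj;
  adj_irrefl : irreflexive adj
}.

Definition bipartite (G : sgraph) : Prop :=
  exists A : {set vertex G},
    forall u v : vertex G, adj u v -> (u \in A) != (v \in A).

Definition list_assignment (G : sgraph) := vertex G -> {fset nat}.

Definition is_k_list_assignment (G : sgraph) (k : nat)
    (L : list_assignment G) : Prop :=
  forall v : vertex G, #|` L v| = k.

Definition proper_list_colouring (G : sgraph) (L : list_assignment G)
    (c : vertex G -> nat) : Prop :=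
  (forall v : vertex G, c v \in L v) /\
  (forall u v : vertex G, adj u v -> c u <> c v).

Definition proper_list_packing (G : sgraph) (L : list_assignment G) (k : nat)
    (c : 'I_k -> vertex G -> nat) : Prop :=
  (forall i : 'I_k, proper_list_colouring L (c i)) /\
  (forall i j : 'I_k, i <> j -> forall v : vertex G, c i v <> c j v).

Definition list_packable (G : sgraph) (k : nat) : Prop :=
  forall L : list_assignment G, is_k_list_assignment k L ->
    exists c : 'I_k -> vertex G -> nat, proper_list_packing L c.

(* [k] ranges over the positive integers: [list_packable G 0] holds vacuously
   for every [G].  A relation rather than a function, so that no default value
   is needed when no [k] is suitable. *)
Definition is_list_packing_number (G : sgraph) (k : nat) : Prop :=
  [/\ 0 < k, list_packable G k
    & forall j : nat, 0 < j -> list_packable G j -> k <= j].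

Definition log2 (R : realType) (x : R) : R := (ln x / ln 2)%R.

(* Main.v *)
Require Import Defs.
From mathcomp Require Import all_boot all_order all_algebra finmap.
From mathcomp Require Import zify.
From mathcomp Require Import boolp reals exp.

(** Fix a bipartite graph with sides A and B, and lists of size k. For every
    pair (x, i) of a colour and an index, flip a fair coin f(x, i) that reserves
    the colour x, in the i-th colouring, for one of the two sides. If every
    colouring c_i uses at a vertex only colours reserved for the side of that
    vertex, then all the c_i are proper, because adjacent vertices lie on
    different sides. So it is enough to find at each vertex v, separately, a
    bijection between the k indices and the list of v that uses only pairs
    (x, i) reserved for the side of v; bijectivity makes the colourings
    disjoint. This is a perfect matching in a uniformly random balanced
    bipartite graph on k + k vertices.

    By Hall's theorem ([hall_marriage]) such a matching can fail to exist only
    if there are sets S of indices and T of colours, nonempty and with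
    |S| + |T| = k + 1, without any edge between them. Fixed sets S, T of sizes
    a, b have this property with probability 2^(-ab), so the failure probability
    is at most the sum of C(k, a) C(k, b) 2^(-ab) over a + b = k + 1. Each
    summand is at most k 2^(-k) once k >= 18 ([bin_mul_bin_leq]); the extreme
    case is that of an isolated vertex. Hence v fails with probability at most
    k^2 2^(-k), and by the union bound some f is good for all n vertices at once
    as soon as n k^2 < 2^k ([exists_matching_sides], [bipartite_list_packable]).

    This condition holds with k = log_2 n + O(log log n), which is below
    (1 + eps) log_2 n for large n. In [exists_packing_size] the cruder choice
    k = m + floor(m / q), with m = floor(log_2 n) and q > 1 / eps, keeps the
    estimate within the natural numbers. Probabilities appear throughout as
    cardinalities of sets of functions f. *)

Set Implicit Arguments.
Unset Strict Implicit.
Unset Printing Implicit Defensive.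

Import Order.TTheory GRing.Theory Num.Theory.

(** * Hall's marriage theorem *)

Definition hall_condition (I C : finType) (F : I -> {set C}) : bool :=
  [forall S : {set I}, #|S| <= #|\bigcup_(i in S) F i|].

Definition delete_at (I C : finType) (F : I -> {set C}) (i : I) (x : C) :
    I -> {set C} :=
  fun j => if j == i then F i :\ x else F j.

(** Rado's step. If deleting x and deleting y both broke Hall's condition, there
    would be sets S, S' containing i that violate it, with neighbourhoods X, Y
    after deletion. As x <> y, the union of X and Y still contains all the
    original neighbours of the union of S and S', and their intersection those
    of the intersection of S and S' without i. Counting with
    inclusion-exclusion, |X| + |Y| is at least |S| + |S'| - 1, whereas the two
    violations give at most |S| + |S'| - 2. *)
Lemma hall_condition_delete (I C : finType) (F : I -> {set C}) i x y :
  hall_condition F -> x != y ->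
  hall_condition (delete_at F i x) || hall_condition (delete_at F i y).
Proof.
move=> /forallP hF xy; case: (boolP (hall_condition _)) => //= nx.
case: (boolP (hall_condition _)) => // ny.
have violator z : ~~ hall_condition (delete_at F i z) ->
    exists2 S : {set I}, i \in S & #|\bigcup_(j in S) delete_at F i z j| < #|S|.
  rewrite negb_forall => /existsP[S]; rewrite -ltnNge => hS.
  exists S => //; apply: contraLR hS => iS.
  rewrite -leqNgt (eq_bigr F) // => j jS; rewrite /delete_at.
  by case: eqP => // ji; rewrite ji (negPf iS) in jS.
have [S iS ltS] := violator _ nx; have [S' iS' ltS'] := violator _ ny.
set X := \bigcup_(j in S) _ in ltS; set Y := \bigcup_(j in S') _ in ltS'.
have leU : #|S :|: S'| <= #|X :|: Y|.
  apply: leq_trans (hF _) (subset_leq_card _).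
  apply/subsetP => z /bigcupP[j jSS zj]; rewrite inE.
  have [jE|ji] := eqVneq j i.
    have [zx|zx] := eqVneq z x.
      apply/orP; right; apply/bigcupP; exists i => //.
      by rewrite /delete_at eqxx !inE zx xy -zx -jE.
    apply/orP; left; apply/bigcupP; exists i => //.
    by rewrite /delete_at eqxx !inE zx -jE.
  by move: jSS; rewrite inE => /orP[jS|jS]; apply/orP; [left|right];
    apply/bigcupP; exists j; rewrite // /delete_at (negPf ji).
have leI : #|(S :&: S') :\ i| <= #|X :&: Y|.
  apply: leq_trans (hF _) (subset_leq_card _).
  apply/subsetP => z /bigcupP[j]; rewrite !inE => /and3P[ji jS jS'] zj.
  by apply/andP; split; apply/bigcupP; exists j; rewrite // /delete_at (negPf ji).
have := cardsUI S S'; have := cardsUI X Y; have := cardsD1 i (S :&: S').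
rewrite inE iS iS' /=; lia.
Qed.

(** By Rado's step, elements can be deleted from the sets F i while Hall's
    condition persists, until every F i is a singleton; the condition on pairs
    then says that these singletons are distinct. *)
Theorem hall_marriage (I C : finType) (F : I -> {set C}) :
  hall_condition F ->
  exists2 g : I -> C, injective g & forall i, g i \in F i.
Proof.
have [n] := ubnP (\sum_i #|F i|); elim: n F => // n IHn F ltn hF.
have [/existsP[i /card_gt1P[x [y [xF yF xy]]]]|] :=
    boolP [exists i, 1 < #|F i|].
  have step z : z \in F i -> hall_condition (delete_at F i z) ->
      exists2 g : I -> C, injective g & forall i, g i \in F i.
    move=> zF hz; case: (IHn _ _ hz) => [|g ginj gF].
      rewrite (leq_trans _ (ltn : _ <= n)) // (bigD1 i) //= [ltnRHS](bigD1 i) //=.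
      rewrite {1}/delete_at eqxx (cardsD1 z (F i)) zF add1n addSn ltnS leq_add2l.
      by apply: leq_sum => j ji; rewrite /delete_at (negPf ji).
    exists g => // j; have := gF j; rewrite /delete_at; case: eqP => // ->.
    by rewrite inE => /andP[].
  by case/orP: (hall_condition_delete i hF xy); apply: step.
rewrite negb_exists => /forallP le1.
have FE i : exists x, F i == [set x].
  have /cards1P[x ->] : #|F i| == 1; last by exists x.
  have /forallP/(_ [set i]) := hF; rewrite big_set1 cards1 => ge1.
  by rewrite eqn_leq ge1 leqNgt le1.
pose g i := xchoose (FE i).
have Fg i : F i = [set g i] by apply/eqP/(xchooseP (FE i)).
exists g => [i j eij|i]; last by rewrite Fg inE.
have /forallP/(_ [set i; j]) := hF.
rewrite bigcup_setU !big_set1 (Fg i) (Fg j) eij setUid cards1 cards2.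
by case: eqP.
Qed.

(** * The binomial estimate *)
Lemma pow4_leq_exp2 k : 18 <= k -> k ^ 4 <= 2 ^ k.-1.
Proof.
elim: k => // k IHk; rewrite leq_eqVlt => /orP[/eqP <-|lek].
  by rewrite -[18]/(2 * 9) expnMn -[_.-1]/(4 + 13) expnD leq_pmul2l.
have {}IHk := IHk lek; case: k lek IHk => //= k lek IHk.
rewrite [2 ^ _]expnS; apply: leq_trans (leq_mul (leqnn 2) IHk).
(* (k+2)/(k+1) <= 7/6, and 7^4 <= 2 * 6^4. *)
rewrite -(@leq_pmul2l (6 ^ 4)) // mulnCA -!expnMn.
apply: (@leq_trans ((7 * k.+1) ^ 4)); first by rewrite leq_exp2r //; lia.
by rewrite !expnMn mulnA leq_mul2r orbC.
Qed.

Lemma leq_bin_exp n m : 'C(n, m) <= n ^ m.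
Proof.
elim: m => [|m IHm]; first by rewrite bin0.
apply: (@leq_trans ('C(n, m.+1) * m.+1)); first by rewrite leq_pmulr.
by rewrite mulnC mul_bin_left expnS leq_mul // leq_subr.
Qed.

(** By symmetry let a <= b, and write a = a' + 1, b = b' + 1, so that
    k = a' + b' + 1 and a b = a' b' + k. Then C(k, b) = C(k, a'), the product of
    the binomials is at most k^(a' + 1) k^a' = k (k^2)^a', and k^2 <= 2^b'
    because b' >= (k - 1) / 2. This last step is where k has to be large. *)
Lemma bin_mul_bin_leq k a b : 18 <= k -> 0 < a -> 0 < b -> a + b = k.+1 ->
  'C(k, a) * 'C(k, b) * 2 ^ k <= k * 2 ^ (a * b).
Proof.
move=> k18; wlog leab : a b / a <= b.
  move=> wl a0 b0 e; have [/wl|/ltnW/wl] := leqP a b; first exact.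
  by rewrite [_ * 'C(k, b)]mulnC [a * b]mulnC; apply; rewrite // addnC.
case: a b leab => // a [//|b] leab _ _ e.
have ek : a + b.+1 = k by lia.
have k2 : k ^ 2 <= 2 ^ b.
  rewrite -(@leq_exp2r _ _ 2) // -!expnM.
  by apply: leq_trans (pow4_leq_exp2 k18) _; rewrite leq_exp2l //; lia.
have -> : a.+1 * b.+1 = a * b + k by lia.
have -> : 'C(k, b.+1) = 'C(k, a) by rewrite -ek -(bin_sub (leq_addr b.+1 a)) addKn.
rewrite expnD mulnA leq_mul2r; apply/orP; right.
apply: (@leq_trans (k ^ a.+1 * k ^ a)); first by rewrite leq_mul ?leq_bin_exp.
rewrite expnS -mulnA leq_mul2l -expnMn mulnn; apply/orP; right.
by rewrite [a * b]mulnC expnM; case: a {leab e ek} => // a; rewrite leq_exp2r.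
Qed.

(** * Counting the assignments without a matching *)

(** The union bound; [m] clears the denominator of the bound c / m on the
    cardinality of each set. *)
Lemma card_bigcup_leq (I T : finType) (P : {pred I}) (F : I -> {set T}) m c :
  (forall i, i \in P -> #|F i| * m <= c) ->
  #|\bigcup_(i in P) F i| * m <= #|P| * c.
Proof.
move=> le; apply: (@leq_trans ((\sum_(i in P) #|F i|) * m)).
  rewrite leq_mul2r; apply/orP; right.
  elim/big_rec2: _ => [|i n A _ leA]; first by rewrite cards0.
  by rewrite (leq_trans (leq_card_setU _ _)) // leq_add2l.
by rewrite big_distrl /= -sum_nat_const; apply: leq_sum.
Qed.

Definition constant_on (X : finType) (D : {set X}) (b : bool) :
    {set {ffun X -> bool}} := [set f : {ffun X -> bool} | [forall x in D, f x == b]].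

Lemma card_constant_on (X : finType) (D : {set X}) b :
  #|constant_on D b| * 2 ^ #|D| = 2 ^ #|X|.
Proof.
have -> : #|constant_on D b| = #|pffun_on b (~: D) (predT : {pred bool})|.
  apply: eq_card => f; rewrite inE; apply/'forall_implyP/pffun_onP.
    move=> h; split=> //; apply/subsetP => x; rewrite !inE; apply: contra; exact: h.
  move=> [/subsetP h _] x; apply: contraLR => fx; move: (h x).
  by rewrite !inE; apply.
rewrite card_pffun_on card_bool -expnD; congr (2 ^ _).
by rewrite addnC cardsC.
Qed.

(** If S violates Hall's condition, more than |P| - |S| elements of P lie
    outside its neighbourhood, and T is cut out of these. Fixing the size of T
    exactly, and not only from below, keeps the number of pairs (S, T) in the
    union bound small. *)
Lemma hall_obstruction (I C : finType) (P : {set C}) (F : I -> {set C}) :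
  (forall i, F i \subset P) -> #|P| = #|I| -> ~~ hall_condition F ->
  exists S : {set I}, exists T : {set C},
    [/\ 0 < #|S|, T \subset P, #|S| + #|T| = #|I|.+1
      & forall i x, i \in S -> x \in T -> x \notin F i].
Proof.
move=> FP cardP; rewrite negb_forall => /existsP[S]; rewrite -ltnNge => ltS.
have S_gt0 : 0 < #|S| by apply: leq_ltn_trans ltS.
pose N := \bigcup_(i in S) F i.
have NP : N \subset P by apply/bigcupsP => i _.
have leSI : #|S| <= #|I| by apply: max_card.
have : #|I|.+1 - #|S| <= #|P :\: N|.
  by rewrite cardsD (setIidPr NP) cardP /N; lia.
move=> /card_geqP[s [us size_s sub_s]]; exists S, [set x in s]; split=> //.
- by apply/subsetP => x; rewrite inE => /sub_s; rewrite inE => /andP[].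
- by rewrite cardsE (card_uniqP us) size_s subnKC // ltnW.
move=> i x iS; rewrite inE => /sub_s; rewrite inE => /andP[xN _].
by apply: contra xN => xF; apply/bigcupP; exists i.
Qed.

(** The event, for a vertex with list P, that some pair (S, T) as in
    [hall_obstruction] with |S| = s + 1 and |T| = k - s receives only b, the
    side opposite to that of the vertex. Since S and T are nonempty, 'I_k is
    exactly the range of s. *)
Definition hall_violators (C : finType) (k : nat) (P : {set C}) (b : bool)
    (s : 'I_k) : {set {ffun C * 'I_k -> bool}} :=
  \bigcup_(ST in setX [set S : {set 'I_k} | S \subset setT & #|S| == s.+1]
                      [set T : {set C} | T \subset P & #|T| == k - s])
    constant_on (setX ST.2 ST.1) b.

Lemma card_hall_violators (C : finType) (k : nat) (P : {set C}) b (s : 'I_k) :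
  18 <= k -> #|P| = k ->
  #|hall_violators P b s| * 2 ^ k <= k * 2 ^ #|{: C * 'I_k}|.
Proof.
move=> k18 cardP; have ltsk := ltn_ord s.
have le1 : #|hall_violators P b s| * 2 ^ (s.+1 * (k - s)) <=
    'C(k, s.+1) * 'C(k, k - s) * 2 ^ #|{: C * 'I_k}|.
  have -> : 'C(k, s.+1) * 'C(k, k - s) =
      #|setX [set S : {set 'I_k} | S \subset setT & #|S| == s.+1]
             [set T : {set C} | T \subset P & #|T| == k - s]|.
    by rewrite cardsX !cards_draws cardsT card_ord cardP.
  apply: card_bigcup_leq => -[S T]; rewrite !inE /=.
  move=> /andP[/andP[_ /eqP cS] /andP[_ /eqP cT]].
  by rewrite -(card_constant_on (setX T S) b) cardsX cS cT [s.+1 * _]mulnC.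
have le2 : 'C(k, s.+1) * 'C(k, k - s) * 2 ^ k <= k * 2 ^ (s.+1 * (k - s)).
  by apply: bin_mul_bin_leq; lia.
rewrite -(@leq_pmul2l (2 ^ (s.+1 * (k - s)))) ?expn_gt0 //.
rewrite mulnA [_ * #|_|]mulnC.
apply: leq_trans (leq_mul le1 (leqnn (2 ^ k))) _.
by rewrite mulnAC mulnA [_ * k]mulnC leq_mul2r le2 orbT.
Qed.

(** The union bound over the n k pairs (v, s): each event has probability at
    most k 2^(-k), so n k^2 < 2^k leaves an assignment f outside all of them, and
    Hall's theorem applies at every vertex. *)
Theorem exists_matching_sides (V C : finType) (k : nat) (L : V -> {set C})
    (side : V -> bool) :
  18 <= k -> (forall v, #|L v| = k) -> #|V| * k ^ 2 < 2 ^ k ->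
  exists f : C -> 'I_k -> bool, forall v, exists2 g : 'I_k -> C,
    injective g & forall i, g i \in L v /\ f (g i) i = side v.
Proof.
move=> k18 cardL ltV.
pose bad := \bigcup_(vs : V * 'I_k) hall_violators (L vs.1) (~~ side vs.1) vs.2.
have /existsP[f] : [exists f, f \notin bad].
  rewrite -negb_forall; apply/forallP => allbad.
  have : #|bad| * 2 ^ k <= #|{: V * 'I_k}| * (k * 2 ^ #|{: C * 'I_k}|).
    by apply: card_bigcup_leq => vs _; apply: card_hall_violators.
  have -> : bad = setT by apply/setP => f; rewrite inE allbad.
  rewrite cardsT card_ffun card_bool mulnC mulnA leq_mul2r expn_eq0 /=.
  by rewrite leqNgt card_prod card_ord -mulnA mulnn ltV.
move=> /bigcupP nbad; exists (fun x i => f (x, i)) => v.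
pose F i := [set x in L v | f (x, i) == side v].
have [g ginj gF] : exists2 g : 'I_k -> C, injective g & forall i, g i \in F i.
  apply: hall_marriage; apply/negPn/negP => nhall; apply: nbad.
  have [||S [T [S0 TL cST noF]]] := hall_obstruction _ _ nhall (P := L v).
  - by move=> i; apply/subsetP => x; rewrite inE => /andP[].
  - by rewrite cardL card_ord.
  have leS : #|S|.-1 < k by have := max_card S; rewrite card_ord; lia.
  rewrite card_ord in cST.
  exists (v, Ordinal leS) => //; apply/bigcupP; exists (S, T); rewrite !inE /=.
    rewrite subsetT TL /= prednK // eqxx /=; apply/eqP.
    have sub_pred a c d : 0 < a -> a + c = d.+1 -> c = d - a.-1 by lia.
    exact: sub_pred cST.
  apply/'forall_implyP => -[x i]; rewrite !inE /= => /andP[xT iS].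
  have := noF i x iS xT; rewrite inE (subsetP TL) //=.
  by case: (f _); case: (side v).
by exists g => // i; have := gF i; rewrite inE => /andP[? /eqP].
Qed.

(** * Packings of bipartite graphs *)
Lemma card_ord_fset M (A : {fset nat}) :
  (forall x, x \in A -> x < M) -> #|[set x : 'I_M | val x \in A]| = #|` A|.
Proof.
move=> ltM; rewrite cardsE.
rewrite -(eq_card (mem_pmap_sub (sT := 'I_M) (enum_fset A))).
rewrite (card_uniqP (pmap_sub_uniq _ (fset_uniq A))) size_pmap_sub.
by apply/eqP; rewrite -all_count; apply/allP.
Qed.

(** The lists are finitely many finite sets, so they embed into some 'I_M. In
    the i-th colouring a colour is reserved for one side, hence adjacent vertices
    never share it. *)
Theorem bipartite_list_packable (G : sgraph) k :
  bipartite G -> 18 <= k -> #|vertex G| * k ^ 2 < 2 ^ k -> list_packable G k.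
Proof.
move=> [A bipA] k18 ltV L cardL.
pose M := (\max_(v : vertex G) \max_(x <- L v) x).+1.
have ltM v x : x \in L v -> x < M.
  move=> xL; rewrite ltnS; apply: leq_trans (leq_bigmax v).
  exact: (leq_bigmax_seq (F := id)).
have [|f fP] := @exists_matching_sides (vertex G) 'I_M k
    (fun v => [set x | val x \in L v]) (fun v => v \in A) k18 _ ltV.
  by move=> v; rewrite card_ord_fset //; apply: ltM.
have {}fP v : exists g : {ffun 'I_k -> 'I_M}, injective g /\
    forall i, val (g i) \in L v /\ f (g i) i = (v \in A).
  have [g ginj gP] := fP v; exists (finfun g); split.
    by move=> i j; rewrite !ffunE; apply: ginj.
  by move=> i; rewrite ffunE; have := gP i; rewrite inE.
have [g gP] := choice fP.
exists (fun i v => val (g v i)); split=> [i|i j neq v /val_inj]; last first.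
  by move/(proj1 (gP v)).
split=> [v|u v uv /val_inj guv]; first by case: (proj2 (gP v) i).
have [_ fu] := proj2 (gP u) i; have [_ fv] := proj2 (gP v) i.
by have := bipA u v uv; rewrite -fu -fv guv eqxx.
Qed.

Lemma exists_list_packing_number (G : sgraph) k :
  0 < k -> list_packable G k ->
  exists j, is_list_packing_number G j /\ j <= k.
Proof.
move=> k0 Gk; pose P j := (0 < j) && `[< list_packable G j >].
have exP : exists j, P j by exists k; rewrite /P k0; apply/asboolP.
case: (ex_minnP exP) => j /andP[j0 /asboolP Gj] minj; exists j; split; last first.
  by apply: minj; rewrite /P k0; apply/asboolP.
by split=> // i i0 Gi; apply: minj; rewrite /P i0; apply/asboolP.
Qed.

(** * Asymptotics *)

(** Let m = floor(log_2 n) and d = floor(m / q), so that k = m + d is at most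
    (1 + 1/q) m. Since n < 2^(m + 1), it remains to see that 2 k^2 <= 2^d. Now
    m < q (d + 1) gives k <= (q + 1) (d + 1), and for d >= 2 (q + 1)^2,
    2 k^2 <= (d + 1)^4 <= 2^d. The lower bound on n ensures that d is that
    large, and at least 17 for the last inequality. *)
Lemma exists_packing_size q n : 0 < q ->
  2 ^ (q * maxn 17 (2 * q.+1 ^ 2)) <= n ->
  exists k, [/\ 18 <= k, n * k ^ 2 < 2 ^ k & q * k <= q.+1 * trunc_log 2 n].
Proof.
move=> q0 len; set m := trunc_log 2 n; pose d := m %/ q.
have n0 : 0 < n by apply: leq_trans len; rewrite expn_gt0.
have led : maxn 17 (2 * q.+1 ^ 2) <= d.
  by rewrite leq_divRL // mulnC; apply: trunc_log_max.
have [d17 dq] : 17 <= d /\ 2 * q.+1 ^ 2 <= d by move: led; rewrite geq_max => /andP.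
have dm : d <= m by apply: leq_div.
have qdm : d * q <= m by apply: leq_divM.
have ltm : m < q * d.+1 by rewrite mulnC ltn_ceil.
exists (m + d); split.
- by clear -d17 dm; lia.
- apply: (@leq_trans (2 ^ m.+1 * (m + d) ^ 2)).
    by rewrite ltn_pmul2r ?trunc_log_ltn // expn_gt0; clear -d17; lia.
  rewrite (expnS 2 m) (mulnC 2) -mulnA (expnD 2 m d) leq_mul2l; apply/orP; right.
  apply: leq_trans (pow4_leq_exp2 (d17 : 18 <= d.+1)).
  have le1 : m + d <= q.+1 * d.+1 by clear -ltm; lia.
  apply: (@leq_trans (2 * (q.+1 * d.+1) ^ 2)); first by rewrite leq_mul2l leq_exp2r.
  rewrite expnMn mulnA (@expnD d.+1 2 2) leq_mul2r; apply/orP; right.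
  by rewrite (leq_trans dq) // expnS expn1; clear; nia.
- by rewrite mulnDr mulSn addnC leq_add2r mulnC.
Qed.

Local Open Scope ring_scope.

Lemma trunc_log2_le (R : realType) (n : nat) : (0 < n)%N ->
  (trunc_log 2 n)%:R <= log2 n%:R :> R.
Proof.
move=> n0; rewrite /log2 ler_pdivlMr ?ln_gt0 ?ltr1n // mulr_natl -lnXn ?ltr0n //.
by rewrite ler_ln ?posrE ?exprn_gt0 ?ltr0n // -natrX ler_nat trunc_logP.
Qed.

Theorem theorem29 (R : realType) (eps : R) (heps : 0 < eps) :
  exists n0 : nat, forall G : sgraph,
    bipartite G -> (n0 <= #|vertex G|)%N ->
    exists k : nat, is_list_packing_number G k /\
      k%:R <= (1 + eps) * log2 (#|vertex G|%:R).
Proof.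
(* An integer q > 1 / eps, so that 1 + 1/q < 1 + eps. *)
pose q := (Num.truncn eps^-1).+1.
have ltq : eps^-1 < q%:R by apply: truncnS_gt.
have q0 : 0 < q%:R :> R by rewrite ltr0n.
exists (2 ^ (q * maxn 17 (2 * q.+1 ^ 2)))%N => G bipG leG.
have [k [k18 ltk lek]] := exists_packing_size (ltn0Sn _) leG.
have [|j [jP lejk]] := exists_list_packing_number _
  (bipartite_list_packable bipG k18 ltk); first exact: leq_trans k18.
exists j; split=> //.
have n0 : (0 < #|vertex G|)%N by apply: leq_trans leG; rewrite expn_gt0.
apply: (@le_trans _ _ ((1 + eps) * (trunc_log 2 #|vertex G|)%:R)); last first.
  by rewrite ler_pM2l ?trunc_log2_le // addr_gt0.
apply: (@le_trans _ _ k%:R); first by rewrite ler_nat.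
rewrite -(ler_pM2l q0) -natrM mulrA.
apply: (@le_trans _ _ (q.+1%:R * (trunc_log 2 #|vertex G|)%:R)).
  by rewrite -natrM ler_nat.
rewrite ler_wpM2r // mulrDr mulr1 -natr1 lerD2l.
by rewrite -ler_pdivrMr // div1r ltW.
Qed.
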